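(* Let $(X,\mathcal U)$ be a sequentially right $K$-complete quasi-uniform space whose quasi-uniformity is generated by an $F$-quasi-gauge $D$ (i.e. $\mathcal U=\mathcal U_D$), and suppose that the topology $\tau(\mathcal U)$ is $T_1$. Let $F:X\times X\to\mathbb R\cup\{\infty\}$ and $x_0\in X$ satisfy the following conditions, where for $x\in X$ $$S(x)=\{y\in X: F(x,y)+d(y,x)\le 0\ \text{ for all } d\in D\}:$$ (E1) $F(x,x)=0$ for all $x\in X$; (E2) $F(x,z)\le F(x,y)+F(y,z)$ for all $x,y,z\in X$; (E3a) the set $S(x)$ is sequentially $\mathcal U$-closed for every $x\in X$; (E4) $\inf\{F(x_0,y):y\in X\}>-\infty$. Then there exists $z\in S(x_0)$ such that for every $x\in X\setminus\{z\}$ there exists $d_x\in D$ with $F(z,x)+d_x(x,z)>0$.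
   Context: A quasi-uniformity on a set $X$ is a nonempty family $\mathcal U$ of subsets of $X\times X$ which contain the diagonal, closed under supersets and finite intersections, such that for every $U\in\mathcal U$ there is $V\in\mathcal U$ with $V\circ V\subseteq U$, where $M\circ N=\{(x,z):\exists y,\ (x,y)\in M,\ (y,z)\in N\}$. The topology $\tau(\mathcal U)$ has $\{U(x):U\in\mathcal U\}$, $U(x)=\{y\in X:(x,y)\in U\}$, as neighborhood basis at $x$. An $F$-quasi-gauge on $X$ is a family $D$ of functions $d:X\times X\to\mathbb R$ such that: (QF1) $D$ is directed upward (for the pointwise order); (QF2) $d(x,y)\ge 0$ and $d(x,x)=0$ for all $d\in D$, $x,y\in X$; (QF3) for every $d\in D$ there is $d'\in D$ with $d'\ge d$ such that $d(x,y)\le d'(x,z)+d'(z,y)$ for all $x,y,z\in X$. It generates the quasi-uniformity $\mathcal U_D$ having as basis the sets $V_{d,\varepsilon}=\{(x,y)\in X\times X: d(x,y)<\varepsilon\}$, $d\in D$, $\varepsilon>0$. A sequence $(x_n)$ is right $K$-Cauchy if for every $U\in\mathcal U$ there is $n_U\in\mathbb N$ such that $(x_{n+k},x_n)\in U$ for all $n\ge n_U$ and all $k\in\mathbb N$. $(X,\mathcal U)$ is sequentially right $K$-complete if every right $K$-Cauchy sequence is $\tau(\mathcal U)$-convergent to some point of $X$. A set is sequentially $\mathcal U$-closed if it contains every $\tau(\mathcal U)$-limit of every sequence of its elements. *)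

(* Defs.v *)
From HB Require Import structures.
From mathcomp Require Import all_boot all_order all_algebra.
From mathcomp Require Import all_classical all_reals all_analysis.

Set Implicit Arguments.
Unset Strict Implicit.
Unset Printing Implicit Defensive.

Import Order.TTheory GRing.Theory Num.Theory.
Import numFieldNormedType.Exports.

Local Open Scope classical_set_scope.
Local Open Scope ring_scope.
Local Open Scope relation_scope.

(* The axioms of uniformType minus symmetry. [qnbhsE] makes the topology of
   [T] the one whose neighborhoods of [x] have the sections
   [xsection U x = [set y | U (x, y)]] as a basis; as symmetry is missing, it
   matters that the base point is the first coordinate. *)
HB.mixin Record Nbhs_isQuasiUniform_mixin T & Nbhs T := {
  qentourage : set_system (T * T);
  qentourage_filter : Filter qentourage;
  qentourage_diagonal : forall A, qentourage A -> diagonal `<=` A;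
  qentourage_split_ex :
    forall A, qentourage A -> exists2 B, qentourage B & B \; B `<=` A;
  qnbhsE : nbhs = nbhs_ qentourage;
}.

#[short(type="quasiUniformType")]
HB.structure Definition QuasiUniform :=
  {T of Topological T & Nbhs_isQuasiUniform_mixin T}.

HB.factory Record isQuasiUniform T & Choice T := {
  qentourage : set_system (T * T);
  qentourage_filter : Filter qentourage;
  qentourage_diagonal : forall A, qentourage A -> diagonal `<=` A;
  qentourage_split_ex :
    forall A, qentourage A -> exists2 B, qentourage B & B \; B `<=` A;
}.

HB.builders Context T & isQuasiUniform T.

HB.instance Definition _ := @hasNbhs.Build T (nbhs_ qentourage).

Let qnbhs_filter (p : T) : ProperFilter (nbhs p).
Proof.
rewrite /nbhs /= nbhs_E; apply: filter_from_proper; last first.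
  by move=> A entA; exists p; apply/mem_set; apply: qentourage_diagonal entA _ _.
apply: filter_from_filter.
  by exists setT; exact: @filterT qentourage_filter.
move=> A B entA entB; exists (A `&` B); last by rewrite xsectionI.
exact: (@filterI _ _ qentourage_filter).
Qed.

Let qnbhs_singleton (p : T) A : nbhs p A -> A p.
Proof.
rewrite /nbhs /= nbhs_E => -[B entB]; apply; apply/mem_set.
exact: qentourage_diagonal entB _ _.
Qed.

Let qnbhs_nbhs (p : T) A : nbhs p A -> nbhs p (nbhs^~ A).
Proof.
rewrite /nbhs /= nbhs_E => -[B entB pBA].
have [C entC CCB] := qentourage_split_ex entB.
exists C => // q /set_mem pCq; rewrite nbhs_E; exists C => // r /set_mem qCr.
by apply: pBA; apply/mem_set; apply: CCB; exists q.
Qed.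

HB.instance Definition _ := Nbhs_isNbhsTopological.Build T
  qnbhs_filter qnbhs_singleton qnbhs_nbhs.

HB.instance Definition _ := Nbhs_isQuasiUniform_mixin.Build T
  qentourage_filter qentourage_diagonal qentourage_split_ex erefl.

HB.end.

Definition right_K_cauchy (X : quasiUniformType) (x_ : nat -> X) : Prop :=
  forall U : set (X * X), qentourage U ->
    exists N : nat, forall n k : nat, (N <= n)%N -> U (x_ (n + k)%N, x_ n).

Definition seq_right_K_complete (X : quasiUniformType) : Prop :=
  forall x_ : nat -> X, right_K_cauchy x_ -> exists x : X, x_ @ \oo --> x.

Definition seq_closed (X : topologicalType) (A : set X) : Prop :=
  forall (x_ : nat -> X) (x : X),
    (forall n, A (x_ n)) -> x_ @ \oo --> x -> A x.

Section quasi_gauge.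
Variables (R : realType) (X : Type).
Implicit Types D : set (X -> X -> R).

Record F_quasi_gauge D : Prop := {
  fqg_directed : forall d1 d2, D d1 -> D d2 ->
    exists d, [/\ D d, forall x y, d1 x y <= d x y
                     & forall x y, d2 x y <= d x y];
  fqg_ge0 : forall d, D d -> forall x y, 0 <= d x y;
  fqg_refl : forall d, D d -> forall x, d x x = 0;
  fqg_triangle : forall d, D d ->
    exists d', [/\ D d', forall x y, d x y <= d' x y
                      & forall x y z, d x y <= d' x z + d' z y]
}.

Definition gauge_ball (d : X -> X -> R) (e : R) : set (X * X) :=
  [set xy | d xy.1 xy.2 < e].

(* For empty [D] this is the empty family, hence never equal to the
   entourages of a quasi-uniformity. *)
Definition gauge_entourage D : set_system (X * X) :=
  filter_from [set de : (X -> X -> R) * R | D de.1 /\ 0 < de.2]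
              (fun de => gauge_ball de.1 de.2).

Definition ekeland_set D (F : X -> X -> \bar R) (x : X) : set X :=
  [set y | forall d, D d -> (F x y + (d y x)%:E <= 0)%E].

End quasi_gauge.

(* Main.v *)
Require Import Defs.
From HB Require Import structures.
From mathcomp Require Import all_boot all_order all_algebra.
From mathcomp Require Import all_classical all_reals all_analysis.
From mathcomp Require Import lra.

Set Implicit Arguments.
Unset Strict Implicit.
Unset Printing Implicit Defensive.

Import Order.TTheory GRing.Theory Num.Theory.
Import numFieldNormedType.Exports.

Local Open Scope classical_set_scope.
Local Open Scope ring_scope.

(** A point [z] meets the conclusion exactly when [S z = [set z]], where [S] is
    the map [ekeland_set D F].  By (E2) and (QF3) the relation [S x y] is a
    preorder, so a minimal element of it is sought below [x0].

    The values of [phi y := F x0 y] control everything along this preorder: if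
    [S x0 x] and [S x y], then (E2) gives
    [d y x <= - F x y <= phi x - phi y] for all gauges [d] at once
    ([ekeland_set_gauge_le]), and [phi] is bounded below by (E4).  A sequence
    that descends greedily, at each step covering at least half of the possible
    decrease of [phi] ([greedy_descent]), therefore has convergent values, hence
    is right K-Cauchy and has a limit [z].  As the sets [S x] are sequentially
    closed, [z] lies in all [S (x_ n)], so [phi z] is at most the limit [l] of
    the values; a point [w] of [S z] lies in all [S (x_ n)] too and, the descent
    being greedy, [l <= phi w].  Hence [d w z <= phi z - phi w <= 0] for all [d],
    which says that [z] is in every neighborhood of [w]; as the topology is T1,
    [w = z].  The greedy choice needs only one real function, which is why
    sequences suffice although [D] may be uncountable. *)

(** A point that covers half of the possible decrease exists trivially where no
    decrease is possible, and otherwise because the midpoint of [phi x] and the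
    infimum is above the infimum. *)
Lemma half_descent (R : realType) (T : Type) (le : T -> T -> Prop)
    (phi : T -> R) (c : R) (x : T) :
    le x x -> (forall y, le x y -> c <= phi y) ->
  exists2 y, le x y & forall w, le x w -> phi y *+ 2 - phi x <= phi w.
Proof.
move=> lexx clb; set V := phi @` [set y | le x y].
have Vinf : has_inf V.
  split; first by exists (phi x), x.
  by exists c => _ [y xy <-]; exact: clb.
have infV w : le x w -> inf V <= phi w.
  by move=> xw; apply: ge_inf; [exact: Vinf.2|exists w].
have [xinf|ltinf] := leP (phi x) (inf V).
  exists x => // w xw; have := infV w xw; lra.
have eps0 : 0 < (phi x - inf V) / 2 by lra.
have [_ [y xy <-] yinf] := inf_adherent eps0 Vinf.
exists y => // w xw; have := infV w xw; lra.
Qed.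

(** The last conclusion holds since [phi (x_ n.+1) *+ 2 - phi (x_ n)] is at most
    [phi w] and has the same limit as [phi (x_ n)].  Monotonicity and lower bound
    are asked only beyond [x0] because in the application [phi] is the real part
    of an extended real function that is finite there. *)
Lemma greedy_descent (R : realType) (T : Type) (le : T -> T -> Prop)
    (phi : T -> R) (c : R) (x0 : T) :
    (forall x, le x x) -> (forall y x z, le x y -> le y z -> le x z) ->
    (forall x y, le x0 x -> le x y -> phi y <= phi x) ->
    (forall x, le x0 x -> c <= phi x) ->
  exists (x_ : nat -> T) (l : R),
    [/\ x_ 0 = x0,
        forall n m, (n <= m)%N -> le (x_ n) (x_ m),
        phi (x_ n) @[n --> \oo] --> l &
        forall w, (forall n, le (x_ n) w) -> l <= phi w].
Proof.
move=> lexx letr phimon clb.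
have step x : {y | le x0 x ->
    le x y /\ forall w, le x w -> phi y *+ 2 - phi x <= phi w}.
  apply: cid; have [x0x|nx0x] := pselect (le x0 x); last by exists x.
  have [|y xy yP] := @half_descent _ _ le phi c x (lexx x); last by exists y.
  by move=> y xy; apply: clb; exact: letr xy.
pose x_ n := iter n (fun x => sval (step x)) x0.
have x0x n : le x0 (x_ n).
  elim: n => [|n IH]; first exact: lexx.
  exact: letr IH (svalP (step (x_ n)) IH).1.
have xS n : le (x_ n) (x_ n.+1) := (svalP (step (x_ n)) (x0x n)).1.
have xhalf n w : le (x_ n) w -> phi (x_ n.+1) *+ 2 - phi (x_ n) <= phi w.
  exact: (svalP (step (x_ n)) (x0x n)).2.
have xle n m : (n <= m)%N -> le (x_ n) (x_ m) by apply: homo_leq.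
have phicvg : cvgn (phi \o x_).
  apply: nonincreasing_is_cvgn; last by exists c => _ [n _ <-]; exact: clb.
  by move=> n m nm; apply: phimon; [exact: x0x|exact: xle].
exists x_, (limn (phi \o x_)); split => // w xw.
have phiScvg : phi (x_ n.+1) *+ 2 - phi (x_ n) @[n --> \oo]
    --> limn (phi \o x_) *+ 2 - limn (phi \o x_).
  apply: cvgB => //; rewrite mulr2n; under eq_fun do rewrite mulr2n.
  by apply: cvgD; rewrite (cvg_shiftS (phi \o x_)).
have <- : limn (phi \o x_) *+ 2 - limn (phi \o x_) = limn (phi \o x_).
  by rewrite mulr2n addrK.
rewrite -(cvg_lim _ phiScvg)//; apply: limr_le; first exact: cvgP phiScvg.
by apply: nearW => n; exact: xhalf.
Qed.

Section ekeland_preorder.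
Context (R : realType) (X : Type) (D : set (X -> X -> R)).
Context (F : X -> X -> \bar R).
Hypothesis hD : F_quasi_gauge D.
Hypothesis hE2 : forall x y z : X, (F x z <= F x y + F y z)%E.

Lemma ekeland_set_refl (x : X) : F x x = 0%E -> ekeland_set D F x x.
Proof. by move=> Fxx d Dd; rewrite Fxx (fqg_refl hD)// adde0. Qed.

Lemma ekeland_set_trans (y x z : X) :
  ekeland_set D F x y -> ekeland_set D F y z -> ekeland_set D F x z.
Proof.
move=> xy yz d Dd; have [d' [Dd' _ dtri]] := fqg_triangle hD Dd.
have dle : ((d z x)%:E <= (d' y x)%:E + (d' z y)%:E)%E.
  by rewrite -EFinD lee_fin addrC dtri.
apply: (le_trans (leeD (hE2 x y z) dle)).
by rewrite addeACA; apply: adde_le0; [exact: xy|exact: yz].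
Qed.

Hypothesis hF : forall x y : X, F x y != -oo%E.
Hypothesis hD0 : D !=set0.

Lemma ekeland_set_fin_num (x y : X) :
  ekeland_set D F x y -> F x y \is a fin_num.
Proof.
move=> xy; have [d Dd] := hD0.
by move: (xy d Dd) (hF x y); case: (F x y).
Qed.

(** Since [S x y] bounds [d y x] by [- F x y], and (E2) bounds that by the
    decrease of [F x0] from [x] to [y]. *)
Lemma ekeland_set_gauge_le (x0 x y : X) (d : X -> X -> R) :
    ekeland_set D F x0 x -> ekeland_set D F x y -> D d ->
  d y x <= fine (F x0 x) - fine (F x0 y).
Proof.
move=> x0x xy Dd; move: (hE2 x0 x y) (xy d Dd).
rewrite -(fineK (ekeland_set_fin_num x0x)) -(fineK (ekeland_set_fin_num xy)).
rewrite -(fineK (ekeland_set_fin_num (ekeland_set_trans x0x xy))).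
rewrite -!EFinD !lee_fin; lra.
Qed.

End ekeland_preorder.

(** The whole product is an entourage, and must contain a gauge ball. *)
Lemma gauge_nonempty (R : realType) (X : quasiUniformType)
    (D : set (X -> X -> R)) :
  @qentourage X = gauge_entourage D -> D !=set0.
Proof.
move=> hgen; have := @filterT _ _ (@qentourage_filter X).
by rewrite hgen => -[[d e] [Dd _] _]; exists d.
Qed.

(** The hypothesis on [d w z] puts [z] in every gauge ball around [w], hence in
    every neighborhood of [w]. *)
Lemma gauge_accessible_eq (R : realType) (X : quasiUniformType)
    (D : set (X -> X -> R)) (w z : X) :
    @qentourage X = gauge_entourage D -> accessible_space X ->
    (forall d, D d -> d w z <= 0) ->
  w = z.
Proof.
move=> hgen hT1 dwz; apply/eqP/negPn/negP => /hT1 [A].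
case=> oA /set_mem wA /set_mem; apply.
have: nbhs w A by exact: open_nbhs_nbhs.
rewrite qnbhsE => -[U]; rewrite /= hgen => -[[d e] [/= Dd e0] dU] UA.
by apply/UA/mem_set/dU; exact: le_lt_trans (dwz d Dd) e0.
Qed.

Lemma right_K_cauchy_gauge (R : realType) (X : quasiUniformType)
    (D : set (X -> X -> R)) (x_ : nat -> X) :
    @qentourage X = gauge_entourage D ->
    (forall (d : X -> X -> R) (e : R), D d -> 0 < e ->
      exists N, forall n k, (N <= n)%N -> d (x_ (n + k)%N) (x_ n) < e) ->
  right_K_cauchy x_.
Proof.
move=> hgen hx U; rewrite hgen => -[[d e] [/= Dd e0] dU].
by have [N hN] := hx d e Dd e0; exists N => n k Nn; apply: dU; exact: hN.
Qed.

Theorem theorem4p17 (R : realType) (X : quasiUniformType)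
    (D : set (X -> X -> R)) (F : X -> X -> \bar R) (x0 : X)
    (hcomplete : seq_right_K_complete X)
    (hD : F_quasi_gauge D)
    (hgen : @qentourage X = gauge_entourage D)
    (hT1 : accessible_space X)
    (hF : forall x y : X, F x y != -oo%E)
    (hE1 : forall x : X, F x x = 0%E)
    (hE2 : forall x y z : X, (F x z <= F x y + F y z)%E)
    (hE3a : forall x : X, seq_closed (ekeland_set D F x))
    (hE4 : (-oo < ereal_inf (range (F x0)))%E) :
  exists2 z : X, ekeland_set D F x0 z &
    forall x : X, x <> z ->
      exists2 d : X -> X -> R, D d & (0 < F z x + (d x z)%:E)%E.
Proof.
have D0 := gauge_nonempty hgen.
have Strans := ekeland_set_trans hD hE2.
have decr x y d := @ekeland_set_gauge_le _ _ _ _ hD hE2 hF D0 x0 x y d.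
pose phi x := fine (F x0 x).
have phimon x y :
    ekeland_set D F x0 x -> ekeland_set D F x y -> phi y <= phi x.
  move=> x0x xy; have [d Dd] := D0; rewrite -subr_ge0.
  exact: le_trans (fqg_ge0 hD Dd y x) (decr _ _ _ x0x xy Dd).
have Srefl x := ekeland_set_refl hD (hE1 x).
have inf_fin : ereal_inf (range (F x0)) \is a fin_num.
  rewrite fin_numE gt_eqF//= lt_eqF//.
  have : (ereal_inf (range (F x0)) <= F x0 x0)%E.
    by apply: ereal_inf_lbound; exists x0.
  by rewrite hE1 => /le_lt_trans; apply; exact: ltry.
have philb x : ekeland_set D F x0 x -> fine (ereal_inf (range (F x0))) <= phi x.
  move=> x0x; apply: fine_le => //.
    exact: ekeland_set_fin_num hF D0 _ _ x0x.
  by apply: ereal_inf_lbound; exists x.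
have [x_ [l [x_0 xle xl lmin]]] := greedy_descent Srefl Strans phimon philb.
have x0x n : ekeland_set D F x0 (x_ n) by rewrite -x_0; exact: xle.
have l_le n : l <= phi (x_ n).
  rewrite -(cvg_lim _ xl)//; apply: limr_le; first exact: cvgP xl.
  near=> m; apply: phimon; first exact: x0x.
  by apply: xle; near: m; exact: nbhs_infty_ge.
have xK : right_K_cauchy x_.
  apply: right_K_cauchy_gauge hgen _ => d e Dd e0.
  have le_e : l < l + e by rewrite ltrDl.
  have [N _ hN] := cvgr_lt _ xl _ le_e.
  exists N => n k Nn.
  apply: le_lt_trans (decr _ _ _ (x0x n) (xle _ _ (leq_addr k n)) Dd) _.
  by have := hN n Nn; have := l_le (n + k)%N; rewrite /phi /=; lra.
have [z xz] := hcomplete _ xK.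
(* The tail of the sequence from [n] on lies in the sequentially closed
   [S (x_ n)]. *)
have Sz n : ekeland_set D F (x_ n) z.
  apply: (hE3a _ (fun m => x_ (m + n)%N)).
    by move=> m; apply: xle; exact: leq_addl.
  exact: cvg_comp (cvg_addnr n) xz.
have x0z : ekeland_set D F x0 z by rewrite -x_0.
have phiz : phi z <= l.
  rewrite -(cvg_lim _ xl)//; apply: limr_ge; first exact: cvgP xl.
  by apply: nearW => n; exact: phimon (x0x n) (Sz n).
exists z => // x xz_neq; apply: contrapT => hno; apply: xz_neq.
have Szx : ekeland_set D F z x.
  by move=> d Dd; rewrite leNgt; apply/negP => dpos; apply: hno; exists d.
apply: (gauge_accessible_eq hgen hT1) => d Dd.
apply: le_trans (decr _ _ _ x0z Szx Dd) _; rewrite subr_le0.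
apply: le_trans phiz _; apply: lmin => n; exact: Strans (Sz n) Szx.
Unshelve. all: by end_near.
Qed.
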